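(* Let $N\ge1$ and let $a_n<b_n$ be real numbers for $1\le n\le N^2$. Let $\boldsymbol\tau(t)$, $t\in[0,1]$, be a geodesic in $\mathbb R^{N^2}$ for the Riemannian metric $M''$ such that it equals $\boldsymbol\tau(1)$ at $t=0$ and $\boldsymbol\tau(2)$ at $t=1$ (here $\boldsymbol\tau(1),\boldsymbol\tau(2)$ denote two given points of $\mathbb R^{N^2}$). Let $\boldsymbol\xi(t)=\boldsymbol\xi(\boldsymbol\tau(t))$ be the corresponding curve in $\prod_{n=1}^{N^2}(a_n,b_n)$, which equals $\boldsymbol\xi(1):=\boldsymbol\xi(\boldsymbol\tau(1))$ at $t=0$ and $\boldsymbol\xi(2):=\boldsymbol\xi(\boldsymbol\tau(2))$ at $t=1$. Then $\boldsymbol\xi(t)$ is a geodesic for the metric $G$, and the geodesic distances $d_G$ and $d_M$ satisfy $$d_G^2(\boldsymbol\xi(1),\boldsymbol\xi(2))=\sum_{n=1}^{N^2}\big(k_n(\xi_n(1))-k_n(\xi_n(2))\big)^2=\sum_{n=1}^{N^2}\big(h_n(\tau_n(1))-h_n(\tau_n(2))\big)^2=d_M^2(\boldsymbol\tau(1),\boldsymbol\tau(2)).$$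
   Context: $M''$ denotes the Riemannian metric on $\mathbb R^{N^2}$ given by the (diagonal) Hessian matrix of $M(\boldsymbol\tau)=\sum_{n=1}^{N^2}\ln\big(e^{-a_n\tau_n}+e^{-b_n\tau_n}\big)$, and $d_M$ is its geodesic distance. The map $\boldsymbol\xi:\mathbb R^{N^2}\to\prod_n(a_n,b_n)$ has components $$\xi_n(\tau_n)=\frac{a_ne^{-a_n\tau_n}+b_ne^{-b_n\tau_n}}{e^{-a_n\tau_n}+e^{-b_n\tau_n}},\quad\text{with inverse}\quad \tau_n(\xi_n)=\frac1{b_n-a_n}\ln\frac{b_n-\xi_n}{\xi_n-a_n}.$$ $G$ is the Riemannian metric on $\prod_n(a_n,b_n)$ obtained by transporting $M''$ through this map: it is diagonal, $G_{n,m}(\boldsymbol\xi)=g_n(\xi_n)\delta_{n,m}$, with $$g_n(\xi_n)=M_n''(\tau_n(\xi_n))\Big(\frac{d\tau_n}{d\xi_n}\Big)^2=\frac1{(b_n-\xi_n)(\xi_n-a_n)},\qquad M_n(\tau)=\ln(e^{-a_n\tau}+e^{-b_n\tau}),$$ and $d_G$ is its geodesic distance. Finally $$h_n(\tau)=2\arctan\big(e^{(b_n-a_n)\tau/2}\big),\qquad k_n(\xi)=\int_{a_n}^{\xi}\frac{du}{\sqrt{(b_n-u)(u-a_n)}},\quad a_n<\xi<b_n.$$ *)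

(* Defs.v *)
(* Built on MathComp-Analysis; the real numbers are an arbitrary [R : realType]. *)
From HB Require Import structures.
From mathcomp Require Import all_boot all_order all_algebra.
From mathcomp Require Import all_classical all_reals all_analysis.

Set Implicit Arguments.
Unset Strict Implicit.
Unset Printing Implicit Defensive.

Import Order.TTheory GRing.Theory Num.Theory.
Import numFieldNormedType.Exports.

Local Open Scope classical_set_scope.
Local Open Scope ring_scope.

Section RiemannianGeometry.
Context {R : realType} {d : nat}.
Implicit Types (x y v w : 'rV[R]_d) (f : 'rV[R]_d -> R) (c : R -> 'rV[R]_d).

(* A metric on an open set [U] of R^d is given by its Gram matrix
   [g x] with respect to the coordinate vector fields; only the values of
   [g] on [U] are relevant. *)
Implicit Types (U : set 'rV[R]_d) (g : 'rV[R]_d -> 'M[R]_d).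

Definition partial (i : 'I_d) f : 'rV[R]_d -> R := 'D_(delta_mx 0 i) f.

Definition hessian f x : 'M[R]_d := \matrix_(i, j) partial i (partial j f) x.

(* Vectors are rows, so [v *m jacobian phi x] is the image of [v] under the
   differential of [phi] at [x]. *)
Definition pullback_metric (phi : 'rV[R]_d -> 'rV[R]_d) g x : 'M[R]_d :=
  jacobian phi x *m g (phi x) *m (jacobian phi x)^T.

Definition christoffel g (k i j : 'I_d) x : R :=
  2^-1 * \sum_(l < d) invmx (g x) k l *
    (partial i (fun y => g y j l) x + partial j (fun y => g y i l) x
     - partial l (fun y => g y i j) x).

Definition geodesic_equation g c (t : R) : Prop :=
  forall k : 'I_d,
    derive1n 2 c t 0 k
    + \sum_(i < d) \sum_(j < d)
        christoffel g k i j (c t) * derive1 c t 0 i * derive1 c t 0 j = 0.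

Definition of_class_C (n : nat) c : Prop :=
  (forall m, (m < n)%N -> forall t, derivable (derive1n m c) t 1)
  /\ continuous (derive1n n c).

(* A curve on [s, t] is of class C^n when it is the restriction of a C^n curve
   on R (equivalently, when its one-sided derivatives at the endpoints
   exist and are continuous up to order n). *)
Definition extends_on (s t : R) (c e : R -> 'rV[R]_d) : Prop :=
  forall u, u \in `[s, t] -> e u = c u.

(* Affinely parametrized geodesics on [0, 1]; the values of [c] outside [0, 1]
   are irrelevant. *)
Definition geodesic U g x y c : Prop :=
  [/\ c 0 = x, c 1 = y &
      exists e, [/\ of_class_C 2 e, extends_on 0 1 c e &
        forall t, t \in `[0, 1] -> U (e t) /\ geodesic_equation g e t]].

Definition piecewise_C1 c : Prop :=
  exists s : seq R, itv_partition 0 1 s /\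
    forall i, (i < size s)%N ->
      exists e, of_class_C 1 e /\ extends_on (nth 0 (0 :: s) i) (nth 0 s i) c e.

Definition admissible_curve U x y c : Prop :=
  [/\ c 0 = x, c 1 = y, (forall t, t \in `[0, 1] -> U (c t)) & piecewise_C1 c].

Definition norm_at g x v : R := Num.sqrt ((v *m g x *m v^T) 0 0).

(* The finitely many points where [c] is not differentiable are negligible. *)
Definition curve_length g c : R :=
  \int[lebesgue_measure]_(t in `[0, 1]) norm_at g (c t) (derive1 c t).

(* [inf] is a genuine infimum: lengths are nonnegative, and on a connected
   open set [U] any two points are joined by an admissible curve. *)
Definition geodesic_distance U g x y : R :=
  inf [set curve_length g c | c in admissible_curve U x y].

End RiemannianGeometry.

Section Coordinates.
Context {R : realType}.
Implicit Types a b t u : R.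

Definition M1 a b t : R := ln (expR (- (a * t)) + expR (- (b * t))).

Definition xi1 a b t : R :=
  (a * expR (- (a * t)) + b * expR (- (b * t)))
  / (expR (- (a * t)) + expR (- (b * t))).

Definition tau1 a b u : R := (b - a)^-1 * ln ((b - u) / (u - a)).

Definition h1 a b t : R :=
  2 * atan (expR ((b - a) * t / 2)).

(* The integrand is singular at [a]; as it is nonnegative, the Lebesgue
   integral is the improper integral. *)
Definition k1 a b u : R :=
  \int[lebesgue_measure]_(v in `]a, u]) (Num.sqrt ((b - v) * (v - a)))^-1.

End Coordinates.

Section Metrics.
Context {R : realType} {d : nat}.
Variables a b : 'I_d -> R.

Definition M (t : 'rV[R]_d) : R := \sum_n M1 (a n) (b n) (t 0 n).

Definition xi (t : 'rV[R]_d) : 'rV[R]_d := \row_n xi1 (a n) (b n) (t 0 n).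

Definition tau (x : 'rV[R]_d) : 'rV[R]_d := \row_n tau1 (a n) (b n) (x 0 n).

Definition box : set 'rV[R]_d := [set x | forall n, a n < x 0 n < b n].

Definition metricM : 'rV[R]_d -> 'M[R]_d := hessian M.

(* [tau] is the inverse of [xi] (from R^d onto [box]), so transporting [metricM]
   through [xi] means pulling it back by [tau]. *)
Definition metricG : 'rV[R]_d -> 'M[R]_d := pullback_metric tau metricM.

Definition distM : 'rV[R]_d -> 'rV[R]_d -> R := geodesic_distance setT metricM.

Definition distG : 'rV[R]_d -> 'rV[R]_d -> R := geodesic_distance box metricG.

End Metrics.

(* Main.v *)
(** In dimension one, a metric [dH ^+ 2] becomes the Euclidean metric in the
    coordinate [H].  Both metrics are diagonal with the [n]-th entry depending
    on the [n]-th coordinate only, so they are flat: with [H n = h1 (a n) (b n)]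
    for [M''] and [H n = h1 (a n) (b n) \o tau1 (a n) (b n)] for [G], the speed
    of a curve [c] is the Euclidean norm of the velocity of [H n (c n)], and [c]
    is a geodesic exactly when every [H n (c n)] is affine.  Integrating that
    velocity, Cauchy-Schwarz bounds every length below by the Euclidean distance
    of the end points in the coordinates [H], and a geodesic attains this bound.
    The map [xi] does not change these coordinates, hence it maps geodesics to
    geodesics; and [k1 \o xi1 = pi - h1], as both sides have the same derivative
    and vanish at infinity. *)
Require Import Defs.
From mathcomp Require Import all_boot all_order all_algebra.
From mathcomp Require Import all_classical all_reals all_analysis.
From mathcomp Require Import measurable_realfun.
From mathcomp Require Import ring.

Set Implicit Arguments.
Unset Strict Implicit.
Unset Printing Implicit Defensive.

Import Order.TTheory GRing.Theory Num.Theory.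
Import numFieldNormedType.Exports.

Local Open Scope classical_set_scope.
Local Open Scope ring_scope.

(** * Diagonal matrices and the Cauchy-Schwarz inequality *)

Lemma invmx_diag (F : fieldType) d (r : 'rV[F]_d) :
  (forall n, r 0 n != 0) -> invmx (diag_mx r) = diag_mx (\row_n (r 0 n)^-1).
Proof.
move=> r0; have rV : diag_mx r *m diag_mx (\row_n (r 0 n)^-1) = 1%:M.
  rewrite mul_diag_mx; apply/matrixP => i j; rewrite !mxE.
  by case: eqP => [->|]; rewrite ?mulr0n ?mulr0// !mulr1n divff.
by rewrite -[RHS](mulKmx (mulmx1_unit rV).1) rV mulmx1.
Qed.

Lemma diag_quadratic_form (R : pzRingType) d (r v : 'rV[R]_d) :
  (v *m diag_mx r *m v^T) 0 0 = \sum_n v 0 n * r 0 n * v 0 n.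
Proof. by rewrite mul_mx_diag !mxE; apply: eq_bigr => n _; rewrite !mxE. Qed.

(** With [A], [B] the sums of squares and [S] the sum of products, [A * (A * B - S ^+ 2)] is itself
    a sum of squares. The case [A = 0] is separate because the proof divides by [A]. *)
Lemma sum_mul_le_sqrt (R : rcfType) (I : finType) (v w : I -> R) :
  \sum_i v i * w i <=
  Num.sqrt (\sum_i v i ^+ 2) * Num.sqrt (\sum_i w i ^+ 2).
Proof.
have ge0 (u : I -> R) : 0 <= \sum_i u i ^+ 2.
  by apply: sumr_ge0 => i _; exact: sqr_ge0.
rewrite -sqrtrM// (le_trans (ler_norm _))// -sqrtr_sqr.
set A := \sum_i v i ^+ 2; set B := \sum_i w i ^+ 2; set S := \sum_i v i * w i.
apply: ler_wsqrtr; have [A0|A0] := eqVneq A 0.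
  rewrite A0 mul0r /S big1 ?expr0n// => i _.
  have /eqP : v i ^+ 2 = 0.
    by apply: (psumr_eq0P _ A0) => // j _; exact: sqr_ge0.
  by rewrite expf_eq0/= => /eqP ->; rewrite mul0r.
have Agt0 : 0 < A by rewrite lt_neqAle eq_sym A0 ge0.
rewrite -subr_ge0 -(pmulr_rge0 _ Agt0).
suff -> : A * (A * B - S ^+ 2) = \sum_i (A * w i - S * v i) ^+ 2 by exact: ge0.
transitivity (\sum_i (A ^+ 2 * w i ^+ 2 +
    (S ^+ 2 * v i ^+ 2 - 2 * A * S * (v i * w i)))).
  by rewrite !big_split/= sumrN -!mulr_sumr -/A -/B -/S; ring.
by apply: eq_bigr => i _; ring.
Qed.

(** * Coordinatewise calculus for row-valued functions *)

Section RowFunctions.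
Context {R : realType} {d : nat}.
Implicit Types (x v : 'rV[R]_d) (c : R -> 'rV[R]_d).

(** The two difference quotients agree for every [h], so derivatives of a function of one coordinate
    reduce to scalar ones in the direction [v 0 n], which may be [0]. *)
Lemma growth_rate_coord (f : R -> R) x v n :
  (fun h => h^-1 *: (f ((h *: v + x) 0 n) - f (x 0 n))) =
  (fun h => h^-1 *: (f (h *: v 0 n + x 0 n) - f (x 0 n))).
Proof. by apply/funext => h; rewrite !mxE. Qed.

Lemma derive_coord (f : R -> R) x v n :
  'D_v (fun y : 'rV[R]_d => f (y 0 n)) x = 'D_(v 0 n) f (x 0 n).
Proof. by rewrite /derive /= growth_rate_coord. Qed.

Lemma derivable_coord (f : R -> R) x v n :
  derivable f (x 0 n) (v 0 n) ->
  derivable (fun y : 'rV[R]_d => f (y 0 n)) x v.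
Proof. by rewrite /derivable /= growth_rate_coord. Qed.

Lemma derivable_rowP c t :
  derivable c t 1 <-> forall n, derivable (fun u => c u 0 n) t 1.
Proof.
rewrite derivable_mxP; split => [dc n|dc i n]; first exact: dc.
by rewrite (ord1 i).
Qed.

Lemma derive1_row c t n :
  derivable c t 1 -> derive1 c t 0 n = derive1 (fun u => c u 0 n) t.
Proof. by move=> dc; rewrite !derive1E derive_mx// mxE. Qed.

Lemma is_derive_row c t n : derivable c t 1 ->
  is_derive t 1 (fun u => c u 0 n) (derive1 c t 0 n).
Proof.
move=> dc; rewrite derive1_row// derive1E; apply: derivableP.
exact: (derivable_rowP c t).1.
Qed.

Lemma continuous_row c :
  (forall n, continuous (fun u => c u 0 n)) -> continuous c.
Proof.
move=> cc t; apply/cvgrPdist_le => /= e e0.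
near=> u; rewrite /Num.Def.normr/= mx_normrE (bigmax_le _ (ltW e0))//= => i _.
rewrite !mxE (ord1 i.1).
move: i; near: u; apply: filter_forall => /= i.
exact: ((cvgrPdist_le _ _).1 (cc i.2 t)).
Unshelve. all: by end_near. Qed.

Lemma differentiable_row (f : 'I_d -> R -> R) x :
  (forall n, derivable (f n) (x 0 n) 1) ->
  differentiable (fun y : 'rV[R]_d => \row_n f n (y 0 n)) x.
Proof.
move=> df.
rewrite (_ : (fun _ => _) =
  \sum_n (fun y : 'rV[R]_d => f n (y 0 n) *: (delta_mx 0 n : 'rV[R]_d))).
  apply: differentiable_sum => n; apply: differentiableZl.
  apply: (@differentiable_comp _ _ _ _ (fun y : 'rV[R]_d => y 0 n) (f n)).
    exact: differentiable_coord.
  exact/derivable1_diffP.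
apply/funext => y; rewrite fct_sumE [LHS]row_sum_delta.
by apply: eq_bigr => n _; rewrite mxE.
Qed.

End RowFunctions.

Lemma continuous_sum (T : topologicalType) (R : numFieldType) (I : finType)
    (f : I -> T -> R) x :
  (forall i, {for x, continuous (f i)}) ->
  {for x, continuous (fun u => \sum_i f i u)}.
Proof.
move=> cf; apply: (@cvg_big R I +%R 0 predT).
  exact: add_continuous.
by move=> i _; exact: cf.
Qed.

(** * Metrics that are flat in separate coordinates *)

(** [dH] is only asked not to vanish: its sign is free, because [h1] is increasing while
    [h1 \o tau1] is decreasing. *)
Definition flat_coordinate (R : realType) (I : set R) (H dH ddH : R -> R) :=
  forall u, I u ->
    [/\ is_derive u 1 H (dH u), is_derive u 1 dH (ddH u) & dH u != 0].

Definition row_box (R : realType) d (I : 'I_d -> set R) : set 'rV[R]_d :=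
  [set x : 'rV[R]_d | forall n, I n (x 0 n)].

Section FlatMetric.
Context {R : realType} {d : nat}.
Variables (I : 'I_d -> set R) (H dH ddH : 'I_d -> R -> R).
Variable g : 'rV[R]_d -> 'M[R]_d.
Hypothesis openI : forall n, open (I n).
Hypothesis flatH : forall n, flat_coordinate (I n) (H n) (dH n) (ddH n).

Let U := row_box I.

Hypothesis gE : forall x, U x -> g x = diag_mx (\row_n dH n (x 0 n) ^+ 2).

(** * Christoffel symbols and the geodesic equation *)

Lemma near_row_box (x : 'rV[R]_d) : U x -> \forall y \near x, U y.
Proof.
move=> Ux.
pose In n := [set y : 'rV[R]_d | I n (y 0 n)].
apply (@filter_forall _ _ In (nbhs x) (nbhs_filter x)) => n.
have Ixn : nbhs (x 0 n) (I n) by apply: open_nbhs_nbhs; split; [exact: openI|].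
exact: (@coord_continuous R 1 d 0 n x _ Ixn).
Qed.

Lemma norm_at_flat x v : U x ->
  norm_at g x v = Num.sqrt (\sum_n (dH n (x 0 n) * v 0 n) ^+ 2).
Proof.
move=> Ux; rewrite /norm_at gE// diag_quadratic_form; congr Num.sqrt.
by apply: eq_bigr => n _; rewrite mxE; ring.
Qed.

Lemma partial_flat x i j l : U x ->
  partial i (fun y => g y j l) x =
  (2 * dH j (x 0 j) * ddH j (x 0 j)) *+ ((i == j) && (j == l)).
Proof.
move=> Ux; rewrite /partial.
(* The form of [g] is known on [U] only, so the entry is replaced in a neighbourhood of [x]. *)
have -> : 'D_(delta_mx 0 i) (fun y => g y j l) x =
    'D_(delta_mx 0 i) (fun y : 'rV[R]_d => (dH j (y 0 j) ^+ 2) *+ (j == l)) x.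
  apply: near_eq_derive; near=> y.
  by rewrite gE ?mxE//; near: y; exact: near_row_box.
rewrite (derive_coord (fun z => (dH j z ^+ 2) *+ (j == l))) mxE eqxx /=.
have [_ dd _] := flatH (Ux j).
rewrite (eq_sym i j); have [_|_] := eqVneq j i; last by rewrite derive0.
have [_|_] := eqVneq j l; last by rewrite /= mulr0n; exact: derive_cst.
rewrite /= !mulr1n (_ : (fun _ => _) = dH j ^+ 2); last exact/funext.
by apply: derive_val; apply: is_derive_eq; rewrite /GRing.scale /=; ring.
Unshelve. all: by end_near. Qed.

(** As the inverse metric is diagonal, only [l = k] contributes. The three partial derivatives
    vanish unless [i = j = k], where two of them cancel and one [2 * dH * ddH] is left to be divided
    by [2 * dH ^+ 2]. *)
Lemma christoffel_flat k i j x : U x ->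
  christoffel g k i j x =
  (ddH k (x 0 k) / dH k (x 0 k)) *+ ((i == k) && (j == k)).
Proof.
move=> Ux; have dH0 n : dH n (x 0 n) != 0 by have [] := flatH (Ux n).
rewrite /christoffel gE// invmx_diag => [|n]; last by rewrite mxE expf_neq0.
rewrite (bigD1 k)//= big1 ?addr0 => [|l lk]; last first.
  by rewrite !mxE eq_sym (negbTE lk) mulr0n mul0r.
rewrite !mxE eqxx mulr1n !partial_flat//.
have [->|ik] := eqVneq i k; have [->|_] := eqVneq j k;
  rewrite ?(negbTE ik) ?eqxx ?andbT ?andbF /= ?mulr1n ?mulr0n; try by ring.
by field; exact: dH0.
Qed.

(** For twice differentiable [c], the right-hand equation says that the second derivative of
    [H k (c t 0 k)] is zero; it is the geodesic equation multiplied by [dH k]. *)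
Lemma geodesic_equation_flat c t : U (c t) ->
  geodesic_equation g c t <-> forall k,
    dH k (c t 0 k) * derive1n 2 c t 0 k
    + ddH k (c t 0 k) * derive1 c t 0 k ^+ 2 = 0.
Proof.
move=> Uc; rewrite /geodesic_equation.
have E k : \sum_(i < d) \sum_(j < d)
      christoffel g k i j (c t) * derive1 c t 0 i * derive1 c t 0 j =
    ddH k (c t 0 k) / dH k (c t 0 k) * derive1 c t 0 k ^+ 2.
  rewrite (bigD1 k)//= (bigD1 k)//= christoffel_flat// eqxx/= mulr1n.
  rewrite [X in _ + X + _]big1 => [|j jk]; last first.
    by rewrite christoffel_flat// (negbTE jk) andbF mulr0n !mul0r.
  rewrite [X in _ + X]big1 => [|i ik]; last first.
    rewrite big1// => j _.
    by rewrite christoffel_flat// (negbTE ik)/= mulr0n !mul0r.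
  by rewrite !addr0 -mulrA -expr2.
have dH0 k : dH k (c t 0 k) != 0 by have [] := flatH (Uc k).
split=> h k; [have := h k; rewrite E => hk|rewrite E].
  rewrite (_ : _ + _ = dH k (c t 0 k) * (derive1n 2 c t 0 k +
      ddH k (c t 0 k) / dH k (c t 0 k) * derive1 c t 0 k ^+ 2)).
    by rewrite hk mulr0.
  by field; exact: dH0.
apply: (mulfI (dH0 k)); rewrite mulr0 -[RHS](h k).
by field; exact: dH0.
Qed.

(** * The lower bound on lengths *)

Implicit Types (x y v : 'rV[R]_d) (c e : R -> 'rV[R]_d).
Implicit Types (n : 'I_d) (s t r u : R).

Definition flat_velocity (e : R -> 'rV[R]_d) n u :=
  dH n (e u 0 n) * derive1 e u 0 n.

Let speed c u := norm_at g (c u) (derive1 c u).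

Lemma speed_flat e u : U (e u) ->
  speed e u = Num.sqrt (\sum_n flat_velocity e n u ^+ 2).
Proof. exact: norm_at_flat. Qed.

Lemma is_derive_flat e n u : derivable e u 1 -> U (e u) ->
  is_derive u 1 (fun t => H n (e t 0 n)) (flat_velocity e n u).
Proof.
move=> de Ue; have [dHn _ _] := flatH (Ue n).
apply: (@is_derive1_comp R (H n) (fun t => e t 0 n)) => //.
exact: is_derive_row.
Qed.

Lemma continuous_flat_velocity e n u : of_class_C 1 e -> U (e u) ->
  {for u, continuous (flat_velocity e n)}.
Proof.
move=> [de ce] Ue; have [_ ddHn _] := flatH (Ue n).
have coord (f : R -> 'rV[R]_d) :
    {for u, continuous f} -> {for u, continuous (fun t => f t 0 n)}.
  move=> cf.
  apply: (@continuous_comp _ _ _ f (fun y : 'rV[R]_d => y 0 n)) => //.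
  exact: coord_continuous.
apply: continuousM; last exact/coord/ce.
apply: (@continuous_comp _ _ _ (fun t => e t 0 n) (dH n)).
  apply: coord; apply: differentiable_continuous.
  by apply/derivable1_diffP; exact: de 0 isT u.
by apply: differentiable_continuous; apply/derivable1_diffP; case: ddHn.
Qed.

Lemma integral_flat_velocity s t e (v : 'I_d -> R) : s < t -> of_class_C 1 e ->
  (forall u, u \in `[s, t] -> U (e u)) ->
  (\int[lebesgue_measure]_(u in `[s, t])
     (\sum_n v n * flat_velocity e n u)%:E =
   (\sum_n v n * (H n (e t 0 n) - H n (e s 0 n)))%:E)%E.
Proof.
move=> st Ce Ue.
pose F u := \sum_n v n * H n (e u 0 n).
have dF u : u \in `[s, t] ->
    is_derive u 1 F (\sum_n v n * flat_velocity e n u).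
  move=> ust.
  rewrite (_ : F = \sum_n (v n *: (fun u => H n (e u 0 n)))); last first.
    by apply/funext => w; rewrite fct_sumE.
  apply: is_derive_sum => n; apply: is_deriveZ; apply: is_derive_flat.
    exact: Ce.1 0 isT u.
  exact: Ue.
have cF u : u \in `[s, t] -> {for u, continuous F}.
  move=> ust; apply: differentiable_continuous; apply/derivable1_diffP.
  by case: (dF u ust).
have sst : s \in `[s, t] by rewrite in_itv/= lexx ltW.
have tst : t \in `[s, t] by rewrite in_itv/= lexx ltW.
rewrite (@continuous_FTC2 _ _ F)//.
- rewrite -EFinB /F -sumrB; congr EFin; apply: eq_bigr => n _.
  by rewrite mulrBr.
- apply: continuous_in_subspaceT => u; rewrite inE/= => ust.
  apply: continuous_sum => n; apply: continuousM; first exact: cvg_cst.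
  by apply: continuous_flat_velocity => //; exact: Ue.
- split.
  + by move=> u /subset_itv_oo_cc ust; case: (dF u ust).
  + exact/cvg_at_right_filter/cF.
  + exact/cvg_at_left_filter/cF.
- move=> u /subset_itv_oo_cc ust; rewrite derive1E.
  by apply: derive_val; exact: dF.
Qed.

(** The bound by the Euclidean distance is stated in dual form, against every [v]. It is then linear
    in the displacement and adds up over consecutive intervals. Measurability and the finite value
    [L] are carried along in order to add the integrals. *)
Definition length_bounded_below c (s t : R) :=
  measurable_fun `[s, t] (speed c) /\
  exists2 L, (\int[lebesgue_measure]_(u in `[s, t]) (speed c u)%:E = L%:E)%E &
    forall v : 'I_d -> R, \sum_n v n * (H n (c t 0 n) - H n (c s 0 n)) <=
      Num.sqrt (\sum_n v n ^+ 2) * L.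

Lemma derive1_extends_on (s t : R) (c e : R -> 'rV[R]_d) u :
  extends_on s t c e -> u \in `]s, t[ -> derive1 c u = derive1 e u.
Proof.
move=> ce ust; rewrite !derive1E; apply: near_eq_derive.
near=> w; apply/esym/ce; apply: subset_itv_oo_cc.
by near: w; exact: near_in_itvoo.
Unshelve. all: by end_near. Qed.

Lemma length_bounded_below_piece (s t : R) c e : s < t ->
  of_class_C 1 e -> extends_on s t c e ->
  (forall u, u \in `[s, t] -> U (c u)) -> length_bounded_below c s t.
Proof.
move=> st Ce ce Uc.
have Ue u : u \in `[s, t] -> U (e u) by move=> ust; rewrite ce//; exact: Uc.
(* [phi] is the speed of the [C^1] extension [e], continuous up to the end points. It agrees with
   the speed of [c] inside only: at [s] and [t] the derivative of [c] also depends on its values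
   outside the interval. *)
pose phi u := Num.sqrt (\sum_n flat_velocity e n u ^+ 2).
have sphi u : u \in `]s, t[ -> speed c u = phi u.
  move=> ust; have ust' := subset_itv_oo_cc ust.
  rewrite /speed (derive1_extends_on ce ust) -ce//.
  by rewrite -/(speed e u) speed_flat//; exact: Ue.
have cphi : {within `[s, t], continuous phi}.
  apply: continuous_in_subspaceT => u; rewrite inE/= => ust.
  apply: (@continuous_comp _ _ _ _ Num.sqrt); last exact: sqrt_continuous.
  apply: continuous_sum => n; apply: continuousM;
    by apply: continuous_flat_velocity => //; exact: Ue.
have iphi : lebesgue_measure.-integrable `[s, t] (EFin \o phi).
  by apply: continuous_compact_integrable => //; exact: segment_compact.
have mphi : measurable_fun `[s, t] phi.
  by apply: subspace_continuous_measurable_fun.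
have mphio : measurable_fun `]s, t[ phi.
  by apply: measurable_funS mphi => //; exact: subset_itv_oo_cc.
have mc : measurable_fun `]s, t[ (speed c).
  by apply: eq_measurable_fun mphio => u; rewrite inE/= => /sphi.
split; first exact: measurable_fun_itv_cc mc.
exists (\int[lebesgue_measure]_(u in `[s, t]) phi u).
  rewrite integral_itv_bndoo; last exact/measurable_EFinP.
  rewrite /Rintegral fineK; last exact: integrable_fin_num.
  rewrite [RHS]integral_itv_bndoo; last exact/measurable_EFinP.
  by apply: eq_integral => u; rewrite inE/= => /sphi ->.
move=> v.
(* Both sides become integrals over the same interval, and Cauchy-Schwarz compares the integrands
   pointwise. *)
rewrite -RintegralZl//.
have := integral_flat_velocity v st Ce Ue.
have sst : s \in `[s, t] by rewrite in_itv/= lexx ltW.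
have tst : t \in `[s, t] by rewrite in_itv/= lexx ltW.
rewrite -(ce s sst) -(ce t tst) => /(congr1 fine) /= <-.
apply: le_Rintegral => //.
- apply: continuous_compact_integrable; first exact: segment_compact.
  apply: continuous_in_subspaceT => u; rewrite inE/= => ust.
  apply: continuous_sum => n; apply: continuousM; first exact: cvg_cst.
  by apply: continuous_flat_velocity => //; exact: Ue.
- by apply: (@integrableZl _ _ _ lebesgue_measure `[s, t]%classic _
    (Num.sqrt (\sum_n v n ^+ 2)) (EFin \o phi)).
- by move=> u _; exact: sum_mul_le_sqrt.
Qed.

Lemma length_bounded_below_cat (s t r : R) c : s <= t -> t <= r ->
  length_bounded_below c s t -> length_bounded_below c t r ->
  length_bounded_below c s r.
Proof.
move=> st tr [m1 [L1 i1 b1]] [m2 [L2 i2 b2]].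
have tr' : `]t, r] `<=` `[t, r] by apply: subset_itvr; rewrite bnd_simp.
(* The second interval is taken open at [t] to make the union disjoint; the missing point is
   negligible. *)
have srE : `[s, r]%classic = `[s, t] `|` `]t, r].
  by rewrite -itv_bndbnd_setU// bnd_simp.
have m2' : measurable_fun `]t, r] (speed c) by apply: measurable_funS m2.
split; first by rewrite srE; apply/measurable_funU.
exists (L1 + L2) => [|v].
  rewrite srE ge0_integral_setU//=.
  - rewrite i1 integral_itv_obnd_cbnd ?i2//.
    exact/measurable_EFinP.
  - by apply/measurable_EFinP; apply/measurable_funU.
  - by move=> u _; rewrite lee_fin sqrtr_ge0.
  - apply/disj_setPS => u [/=]; rewrite !in_itv/= => /andP[_ ut] /andP[].
    by rewrite ltNge ut.
rewrite mulrDr (le_trans _ (lerD (b1 v) (b2 v)))// -big_split/=.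
by apply: ler_sum => n _; rewrite -mulrDr [X in _ <= _ * X]addrC subrKA.
Qed.

Lemma length_bounded_below_partition (p q : R) (s : seq R) c :
  itv_partition p q s -> s != [::] ->
  (forall i, (i < size s)%N -> exists e,
     of_class_C 1 e /\ extends_on (nth 0 (p :: s) i) (nth 0 s i) c e) ->
  (forall u, u \in `[p, q] -> U (c u)) -> length_bounded_below c p q.
Proof.
elim: s p => [//|x s IH] p pq _ pieces Uc.
have px : p < x by case: pq => /= /andP[].
have xq : x <= q := itv_partition_le (itv_partition_cons pq).
have px_bound : length_bounded_below c p x.
  have [e [Ce ce]] := pieces 0 isT.
  apply: length_bounded_below_piece px Ce ce _ => u; rewrite in_itv/=.
  by move=> /andP[pu ux]; apply: Uc; rewrite in_itv/= pu (le_trans ux).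
(* If [x] is the last point of the partition, it is [q] and the single piece suffices. *)
have [s0|s0] := eqVneq s [::].
  by move: pq => [_]; rewrite s0/= => /eqP <-.
apply: length_bounded_below_cat (ltW px) xq px_bound _.
apply: (IH x (itv_partition_cons pq) s0) => [i|u].
  by move=> is_; exact: (pieces i.+1).
rewrite in_itv/= => /andP[xu uq]; apply: Uc.
by rewrite in_itv/= uq (le_trans (ltW px)).
Qed.

Definition flat_distance x y : R :=
  Num.sqrt (\sum_n (H n (x 0 n) - H n (y 0 n)) ^+ 2).

Lemma flat_distance_le_length x y c :
  admissible_curve U x y c -> flat_distance x y <= curve_length g c.
Proof.
move=> [c0 c1 Uc [s [s01 pieces]]].
have s0 : s != [::].
  by apply/eqP => s0; move: s01; rewrite s0 => -[_]; rewrite eq_sym oner_eq0.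
have [_ [L cL bL]] := length_bounded_below_partition s01 s0 pieces Uc.
rewrite /curve_length /Rintegral cL /=.
have L0 : 0 <= L.
  rewrite -lee_fin -cL; apply: integral_ge0 => u _.
  by rewrite lee_fin sqrtr_ge0.
(* Testing against the displacement itself gives [A <= Num.sqrt A * L], to be divided by
   [Num.sqrt A] when this is nonzero. *)
have := bL (fun n => H n (y 0 n) - H n (x 0 n)).
rewrite c0 c1; under eq_bigr do rewrite -expr2.
have E : \sum_n (H n (y 0 n) - H n (x 0 n)) ^+ 2 =
    \sum_n (H n (x 0 n) - H n (y 0 n)) ^+ 2.
  by apply: eq_bigr => n _; ring.
rewrite E /flat_distance; set A := \sum_n _ => AL.
have A0 : 0 <= A by apply: sumr_ge0 => n _; exact: sqr_ge0.
have [->//|sA0] := eqVneq (Num.sqrt A) 0.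
have sA : 0 < Num.sqrt A by rewrite lt_neqAle eq_sym sA0 sqrtr_ge0.
by rewrite -(ler_pM2l sA) -expr2 sqr_sqrtr.
Qed.

(** * Geodesics realise the distance *)

Lemma of_class_C_succ (k : nat) c : of_class_C k.+1 c -> of_class_C k c.
Proof.
move=> [dc _]; split=> [m mk t|t]; first exact/dc/ltnW.
by apply: differentiable_continuous; exact/derivable1_diffP/dc.
Qed.

Lemma geodesic_admissible x y c :
  geodesic U g x y c -> admissible_curve U x y c.
Proof.
move=> [c0 c1 [e [Ce ce Ue]]]; split => // [t t01|].
  by rewrite -ce//; have [] := Ue t t01.
exists [:: 1]; split; first exact: itv_partition1.
by case=> // _; exists e; split; [exact: of_class_C_succ|].
Qed.

(** The geodesic equation makes the derivative of the flat velocity zero, so the velocity is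
    constant on [[0, 1]]. The mean value theorem for [H n (e t 0 n)] then identifies the
    constant. *)
Lemma flat_velocity_geodesic e :
  of_class_C 2 e ->
  (forall t, t \in `[0, 1] -> U (e t) /\ geodesic_equation g e t) ->
  forall n t, t \in `[0, 1] ->
    flat_velocity e n t = H n (e 1 0 n) - H n (e 0 0 n).
Proof.
move=> Ce ge n.
have e1 u : derivable e u 1 := Ce.1 0 isT u.
have e2 u : derivable (derive1 e) u 1 := Ce.1 1 isT u.
have Ue u : u \in `[0, 1] -> U (e u) by move=> /ge[].
have dw u : u \in `[0, 1] -> is_derive u 1 (flat_velocity e n) 0.
  move=> u01; have [Uu /(geodesic_equation_flat Uu)/(_ n) geq] := ge u u01.
  have [_ ddHn _] := flatH (Uu n).
  have de := is_derive_row n (e1 u).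
  have dde : is_derive u 1 (fun t => derive1 e t 0 n) (derive1n 2 e u 0 n).
    exact: is_derive_row n (e2 u).
  have dHe := @is_derive1_comp R (dH n) (fun t => e t 0 n) u _ _ ddHn de.
  apply: is_derive_eq; rewrite -[RHS]geq.
  by rewrite /GRing.scale /=; ring.
have constw t : t \in `[0, 1] -> flat_velocity e n t = flat_velocity e n 0.
  rewrite in_itv/= => /andP[t0 t1].
  have sub u : u \in `[0, t] -> u \in `[0, 1].
    by rewrite !in_itv/= => /andP[-> ut]; exact: le_trans t1.
  have dw_oo u : u \in `]0, t[ -> is_derive u 1 (flat_velocity e n) 0.
    by move=> /subset_itv_oo_cc /sub /dw.
  have cw : {within `[0, t], continuous (flat_velocity e n)}.
    by apply: derivable_within_continuous => u /sub /dw[].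
  have [u _] := MVT_segment t0 dw_oo cw.
  by rewrite mul0r => /eqP; rewrite subr_eq0 => /eqP.
have dHe u : u \in `[0, 1] ->
    is_derive u 1 (fun t => H n (e t 0 n)) (flat_velocity e n u).
  by move=> /Ue; exact: is_derive_flat.
have dHe_oo u : u \in `]0, 1[ ->
    is_derive u 1 (fun t => H n (e t 0 n)) (flat_velocity e n u).
  by move=> /subset_itv_oo_cc /dHe.
have cHe : {within `[0, 1], continuous (fun t => H n (e t 0 n))}.
  by apply: derivable_within_continuous => u /dHe[].
have [u u01 ->] := MVT_segment ler01 dHe_oo cHe.
by move=> t /constw ->; rewrite (constw u u01) subr0 mulr1.
Qed.

Lemma geodesic_length x y c :
  geodesic U g x y c -> curve_length g c = flat_distance x y.
Proof.
move=> [c0 c1 [e [Ce ce Ue]]].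
(* The speed is constant on the open interval; the end points, where the derivative of [c] is not
   controlled, do not affect the integral. *)
have sE u : u \in `]0, 1[ -> speed c u = flat_distance x y.
  move=> u01; have u01' := subset_itv_oo_cc u01.
  rewrite /speed (derive1_extends_on ce u01) -ce//.
  rewrite -/(speed e u) speed_flat; last by have [] := Ue u u01'.
  congr Num.sqrt; apply: eq_bigr => n _.
  rewrite (flat_velocity_geodesic Ce Ue)//.
  rewrite !ce ?in_itv/= ?lexx ?ler01// c0 c1; ring.
have mspeed : measurable_fun `](0 : R), 1[ (EFin \o speed c).
  apply/measurable_EFinP/(eq_measurable_fun (cst (flat_distance x y))) => //.
  by move=> u; rewrite inE/= => /sE.
rewrite /curve_length /Rintegral integral_itv_bndoo//.
rewrite (eq_integral (cst (flat_distance x y)%:E)); last first.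
  by move=> u; rewrite inE/= => /sE; rewrite /speed => ->.
rewrite integral_cst//= lebesgue_measure_itv/= lte01 oppr0 adde0 mule1//.
Qed.

(** The given geodesic attains the lower bound valid for all admissible curves, so the infimum is a
    minimum. *)
Lemma geodesic_distance_flat x y c : geodesic U g x y c ->
  geodesic_distance U g x y = flat_distance x y.
Proof.
move=> gc; have adm := geodesic_admissible gc.
apply/le_anti/andP; split.
  rewrite -(geodesic_length gc); apply: ge_inf.
    exists (flat_distance x y) => _ [c' c'adm <-].
    exact: flat_distance_le_length.
  by exists c.
apply: lb_le_inf; first by exists (curve_length g c), c.
by move=> _ [c' c'adm <-]; exact: flat_distance_le_length.
Qed.

End FlatMetric.

(** * The one-dimensional coordinate changes *)

Section OneCoordinate.
Context {R : realType}.
Variables a b : R.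
Hypothesis ab : a < b.
Implicit Types t u : R.

Let e t : R := expR ((b - a) * t / 2).

(** This is [(b - a) / 2] divided by the hyperbolic cosine of [(b - a) * t / 2]; its square is the
    second derivative of [M1 a b]. *)
Definition dh1 t := (b - a) * e t / (1 + e t ^+ 2).

Definition ddh1 t :=
  (b - a) ^+ 2 / 2 * e t * (1 - e t ^+ 2) / (1 + e t ^+ 2) ^+ 2.

Let ba_gt0 : 0 < b - a. Proof. by rewrite subr_gt0. Qed.
Let ba_neq0 : b - a != 0. Proof. by rewrite gt_eqF. Qed.
Let e_gt0 t : 0 < e t. Proof. exact: expR_gt0. Qed.
Let den_gt0 t : 0 < 1 + e t ^+ 2.
Proof. by rewrite addr_gt0// exprn_gt0. Qed.
Let den_neq0 t : 1 + e t ^+ 2 != 0. Proof. by rewrite gt_eqF. Qed.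

Let is_derive_e t : is_derive t 1 e ((b - a) / 2 * e t).
Proof.
have dlin : is_derive t 1 (fun t => (b - a) / 2 * t) ((b - a) / 2).
  rewrite (_ : (fun t => _) = ((b - a) / 2) *: id); last exact/funext.
  by apply: is_derive_eq; rewrite /GRing.scale /= mulr1.
have -> : e = expR \o (fun t => (b - a) / 2 * t).
  by apply/funext => u; rewrite /e /= mulrAC.
apply: (is_derive_eq (is_derive1_comp (is_derive_expR _) dlin)).
by rewrite mulrC.
Qed.

Let is_derive_den t :
  is_derive t 1 (fun t => 1 + e t ^+ 2) ((b - a) * e t ^+ 2).
Proof.
have de := is_derive_e t.
rewrite (_ : (fun t => _) = cst 1 + e ^+ 2); last exact/funext.
by apply: is_derive_eq; rewrite /GRing.scale /=; field.
Qed.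

Lemma is_derive_h1 t : is_derive t 1 (h1 a b) (dh1 t).
Proof.
have de := is_derive_e t.
have datan : is_derive t 1 (fun t => atan (e t))
    ((1 + e t ^+ 2)^-1 * ((b - a) / 2 * e t)).
  exact: (is_derive1_comp (is_derive1_atan (e t)) de).
rewrite (_ : h1 a b = 2 *: (fun t => atan (e t))); last exact/funext.
by apply: is_derive_eq; rewrite /GRing.scale /= /dh1; field; exact: den_neq0.
Qed.

Lemma is_derive_dh1 t : is_derive t 1 dh1 (ddh1 t).
Proof.
have de := is_derive_e t; have dden := is_derive_den t.
have dV : is_derive t 1 (fun t => (1 + e t ^+ 2)^-1)
    (- (1 + e t ^+ 2) ^- 2 *: ((b - a) * e t ^+ 2)).
  by apply: is_deriveV.
rewrite (_ : dh1 = (b - a) *: (e * (fun t => (1 + e t ^+ 2)^-1))); last first.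
  by apply/funext => u; rewrite /dh1 -mulrA.
by apply: is_derive_eq; rewrite /GRing.scale /= /ddh1; field; exact: den_neq0.
Qed.

Lemma dh1_gt0 t : 0 < dh1 t.
Proof. by rewrite /dh1 divr_gt0// mulr_gt0. Qed.

Lemma flat_coordinate_h1 : flat_coordinate setT (h1 a b) dh1 ddh1.
Proof.
by move=> t _; split; [exact: is_derive_h1|exact: is_derive_dh1|];
  rewrite gt_eqF// dh1_gt0.
Qed.

(** The factor [expR (- (b * t))] cancels from numerator and denominator. With [xi1] rational in
    [e t], the identities below become field computations. *)
Lemma xi1E t : xi1 a b t = a + (b - a) / (1 + e t ^+ 2).
Proof.
have -> : xi1 a b t = (a * (expR (- (b * t)) * e t ^+ 2) + b * expR (- (b * t)))
    / (expR (- (b * t)) * e t ^+ 2 + expR (- (b * t))).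
  rewrite /xi1; suff -> : expR (- (a * t)) = expR (- (b * t)) * e t ^+ 2 by [].
  by rewrite /e expr2 -!expRD; congr expR; field.
have B0 : expR (- (b * t)) != 0 by rewrite gt_eqF ?expR_gt0.
rewrite (_ : _ * _ + expR _ = expR (- (b * t)) * (1 + e t ^+ 2)); last by ring.
by field; rewrite den_neq0 B0.
Qed.

Lemma xi1_itv t : a < xi1 a b t < b.
Proof.
rewrite xi1E ltrDl divr_gt0//= -ltrBrDl ltr_pdivrMr// ltr_pMr//.
by rewrite ltrDl exprn_gt0.
Qed.

Lemma sub_xi1 t : b - xi1 a b t = (b - a) * e t ^+ 2 / (1 + e t ^+ 2).
Proof. by rewrite xi1E; field; exact: den_neq0. Qed.

(** Hence the coefficient of [G] at [xi1 a b t] is the inverse of the coefficient of [M''] at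
    [t]. *)
Lemma xi1_mul t : (b - xi1 a b t) * (xi1 a b t - a) = dh1 t ^+ 2.
Proof. by rewrite sub_xi1 xi1E /dh1; field; exact: den_neq0. Qed.

Lemma xi1K : cancel (xi1 a b) (tau1 a b).
Proof.
move=> t; rewrite /tau1 sub_xi1 xi1E [a + _]addrC addrK.
have -> : (b - a) * e t ^+ 2 / (1 + e t ^+ 2) / ((b - a) / (1 + e t ^+ 2)) =
    expR ((b - a) * t).
  rewrite (_ : expR _ = e t ^+ 2); last first.
    by rewrite /e expr2 -expRD; congr expR; field.
  by field; rewrite den_neq0 ba_neq0.
by rewrite expRK mulKf.
Qed.

Lemma tau1K u : a < u < b -> xi1 a b (tau1 a b u) = u.
Proof.
move=> /andP[au ub].
have ua0 : u - a != 0 by rewrite gt_eqF// subr_gt0.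
have eE : e (tau1 a b u) ^+ 2 = (b - u) / (u - a).
  rewrite /e expr2 -expRD (_ : _ + _ = ln ((b - u) / (u - a))).
    by rewrite lnK// posrE divr_gt0// subr_gt0.
  by rewrite /tau1; field; exact: ba_neq0.
rewrite xi1E eE; field; rewrite ua0/=.
by rewrite (_ : _ + _ = b - a)//; ring.
Qed.

(** Since [xi1] is minus the derivative of [M1], this computes the Hessian of [M]. *)
Lemma is_derive_xi1 t : is_derive t 1 (xi1 a b) (- dh1 t ^+ 2).
Proof.
have dden := is_derive_den t.
have dV : is_derive t 1 (fun t => (1 + e t ^+ 2)^-1)
    (- (1 + e t ^+ 2) ^- 2 *: ((b - a) * e t ^+ 2)).
  by apply: is_deriveV.
rewrite (_ : xi1 a b = cst a + (b - a) *: (fun t => (1 + e t ^+ 2)^-1)).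
  by apply: is_derive_eq; rewrite /GRing.scale /= /dh1; field; exact: den_neq0.
by apply/funext => u; rewrite xi1E.
Qed.

Lemma is_derive_M1 t : is_derive t 1 (M1 a b) (- xi1 a b t).
Proof.
have dexp (k : R) : is_derive t 1 (fun t => expR (- (k * t)))
    (expR (- (k * t)) * - k).
  apply: (@is_derive1_comp _ expR (fun t => - (k * t))).
  rewrite (_ : (fun t => - (k * t)) = - (k *: id)); last exact/funext.
  by apply: is_derive_eq; rewrite /GRing.scale /= mulr1.
have s_gt0 : 0 < expR (- (a * t)) + expR (- (b * t)).
  by rewrite addr_gt0 ?expR_gt0.
have dsum := is_deriveD (dexp a) (dexp b).
have dln := @is_derive1_comp _ (@ln R)
  ((fun t => expR (- (a * t))) + (fun t => expR (- (b * t)))) t _ _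
  (is_derive1_ln s_gt0) dsum.
suff <- : (expR (- (a * t)) + expR (- (b * t)))^-1 *
    (expR (- (a * t)) * - a + expR (- (b * t)) * - b) = - xi1 a b t.
  exact: dln.
by rewrite /xi1; field; rewrite gt_eqF.
Qed.

Definition dtau1 u := - ((b - u) * (u - a))^-1.

Definition ddtau1 u := (a + b - 2 * u) / ((b - u) * (u - a)) ^+ 2.

Lemma is_derive_tau1 u : a < u < b -> is_derive u 1 (tau1 a b) (dtau1 u).
Proof.
move=> uab; have := uab => /andP[au ub].
have ua0 : u - a != 0 by rewrite gt_eqF// subr_gt0.
have bu0 : b - u != 0 by rewrite gt_eqF// subr_gt0.
have dV : is_derive u 1 (fun u => (u - a)^-1) (- (u - a) ^- 2 *: 1).
  apply: is_deriveV => //; rewrite (_ : (fun u => u - a) = id - cst a)//.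
  by apply: is_derive_eq; rewrite subr0.
have dq : is_derive u 1 (fun u => (b - u) / (u - a)) (- (b - a) / (u - a) ^+ 2).
  rewrite (_ : (fun u => _) = (cst b - id) * (fun u => (u - a)^-1)).
    by apply: is_derive_eq; rewrite /GRing.scale /= !fctE; field.
  exact/funext.
have dln : is_derive u 1 (fun u => ln ((b - u) / (u - a)))
    (((b - u) / (u - a))^-1 * (- (b - a) / (u - a) ^+ 2)).
  apply: (@is_derive1_comp _ (@ln R) (fun u => (b - u) / (u - a))).
  by apply: is_derive1_ln; rewrite divr_gt0// subr_gt0.
rewrite (_ : tau1 a b = (b - a)^-1 *: (fun u => ln ((b - u) / (u - a)))).
  apply: is_derive_eq; rewrite /GRing.scale /= /dtau1; field.
  by rewrite ua0 bu0 ba_neq0.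
exact/funext.
Qed.

Lemma is_derive_dtau1 u : a < u < b -> is_derive u 1 dtau1 (ddtau1 u).
Proof.
move=> /andP[au ub].
have ua0 : u - a != 0 by rewrite gt_eqF// subr_gt0.
have bu0 : b - u != 0 by rewrite gt_eqF// subr_gt0.
have dP : is_derive u 1 (fun u => (b - u) * (u - a)) (a + b - 2 * u).
  rewrite (_ : (fun u => _) = (cst b - id) * (id - cst a)); last exact/funext.
  by apply: is_derive_eq; rewrite /GRing.scale /= !fctE; ring.
have dV : is_derive u 1 (fun u => ((b - u) * (u - a))^-1)
    (- ((b - u) * (u - a)) ^- 2 *: (a + b - 2 * u)).
  by apply: is_deriveV => //; rewrite mulf_neq0.
rewrite (_ : dtau1 = - (fun u => ((b - u) * (u - a))^-1)); last exact/funext.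
apply: is_derive_eq; rewrite /GRing.scale /= /ddtau1; field.
by rewrite ua0 bu0.
Qed.

Lemma dtau1_xi1 t : dtau1 (xi1 a b t) = - dh1 t ^- 2.
Proof. by rewrite /dtau1 xi1_mul. Qed.

(** On []a, b[] this is minus the integrand of [k1]; the sign comes from [tau1] being decreasing.
    The chain-rule form is the one produced by pulling back the metric. *)
Definition dh1_tau1 u := dh1 (tau1 a b u) * dtau1 u.

Definition ddh1_tau1 u :=
  ddh1 (tau1 a b u) * dtau1 u ^+ 2 + dh1 (tau1 a b u) * ddtau1 u.

Lemma flat_coordinate_h1_tau1 :
  flat_coordinate `]a, b[ (h1 a b \o tau1 a b) dh1_tau1 ddh1_tau1.
Proof.
move=> u /=; rewrite in_itv/= => uab.
have dt := is_derive_tau1 uab; have ddt := is_derive_dtau1 uab.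
have ddh : is_derive u 1 (dh1 \o tau1 a b) (ddh1 (tau1 a b u) * dtau1 u).
  by apply: is_derive1_comp; exact: is_derive_dh1.
split.
- by apply: is_derive1_comp; exact: is_derive_h1.
- rewrite (_ : dh1_tau1 = (dh1 \o tau1 a b) * dtau1); last exact/funext.
  by apply: is_derive_eq; rewrite /GRing.scale /= /ddh1_tau1; ring.
- have dh0 : dh1 (tau1 a b u) != 0 by rewrite gt_eqF// dh1_gt0.
  apply: (mulf_neq0 dh0); rewrite /dtau1 oppr_eq0 invr_eq0.
  move: uab => /andP[au ub].
  by apply: mulf_neq0; rewrite gt_eqF// subr_gt0.
Qed.

Lemma dh1_tau1_xi1 t : dh1_tau1 (xi1 a b t) = - (dh1 t)^-1.
Proof.
rewrite /dh1_tau1 xi1K dtau1_xi1; field.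
by rewrite gt_eqF// dh1_gt0.
Qed.

(** This writes [ddh1] through functions already differentiated, which gives its continuity at
    once. *)
Lemma ddh1E t : ddh1 t = dh1 t * (xi1 a b t - (a + b) / 2).
Proof. by rewrite xi1E /dh1 /ddh1; field; exact: den_neq0. Qed.

Lemma continuous_ddh1 : continuous ddh1.
Proof.
move=> t; rewrite (_ : ddh1 = dh1 * (xi1 a b - cst ((a + b) / 2))); last first.
  by apply/funext => u; rewrite ddh1E.
apply: differentiable_continuous; apply/derivable1_diffP.
have d1 := is_derive_dh1 t; have d2 := is_derive_xi1 t.
by apply: derivableM => //; apply: derivableB.
Qed.

(* Differentiating [h1 \o tau1 \o xi1 = h1] twice, with [- dh1 ^+ 2] the
   derivative of [xi1]. *)
Lemma ddh1_tau1_xi1 t :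
  ddh1_tau1 (xi1 a b t) * (dh1 t ^+ 2) ^+ 2 +
  dh1_tau1 (xi1 a b t) * (- 2 * dh1 t * ddh1 t) = ddh1 t.
Proof.
have dh0 : dh1 t != 0 by rewrite gt_eqF// dh1_gt0.
rewrite dh1_tau1_xi1 /ddh1_tau1 xi1K dtau1_xi1 /ddtau1 xi1_mul.
have key : dh1 t * (a + b - 2 * xi1 a b t) = - 2 * ddh1 t.
  by rewrite ddh1E; field.
transitivity (3 * ddh1 t + dh1 t * (a + b - 2 * xi1 a b t)).
  by field.
by rewrite key; ring.
Qed.

Lemma xi1_decreasing t u : t < u -> xi1 a b u < xi1 a b t.
Proof.
move=> tu; rewrite !xi1E ltrD2l ltr_pM2l// ltf_pV2 ?posrE// ltrD2l.
by rewrite ltr_pXn2r ?nnegrE ?ltW// ltr_expR ltr_pM2r// ltr_pM2l.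
Qed.

Lemma cvg_h1_pi t : h1 a b (t + n%:R) @[n --> \oo] --> (pi : R).
Proof.
rewrite (_ : pi = 2 * (pi / 2)); last by field.
apply: cvgM; first exact: cvg_cst.
apply: (cvg_comp _ _ _ (@cvgy_atan R)).
apply/cvgryPge => A; near=> n.
(* Bounding [expR x] below by [1 + x] reduces divergence to that of a linear function of [n]. *)
rewrite (le_trans _ (expR_ge1Dx _))//.
rewrite -lerBlDl ler_pdivlMr// -ler_pdivrMl// -lerBlDl.
by near: n; exact: nbhs_infty_ger.
Unshelve. all: by end_near. Qed.

(** * The improper integral [k1] *)

Let k1_integrand v := (Num.sqrt ((b - v) * (v - a)))^-1.

Let k1_integrandE v : a < v < b -> k1_integrand v = - dh1_tau1 v.
Proof.
move=> vab; rewrite -(tau1K vab); set t := tau1 a b v.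
rewrite /k1_integrand xi1_mul sqrtr_sqr dh1_tau1_xi1 opprK ger0_norm//.
exact/ltW/dh1_gt0.
Qed.

Let continuous_k1_integrand v :
  a < v < b -> {for v, continuous k1_integrand}.
Proof.
move=> vab.
have /flat_coordinate_h1_tau1[_ [d2 _] _] : `]a, b[%classic v.
  by rewrite /= in_itv.
have : {for v, continuous (- dh1_tau1)}.
  apply: continuousN; apply: differentiable_continuous.
  exact/derivable1_diffP.
rewrite /prop_for /continuous_at [in X in _ --> X -> _]fctE.
rewrite -(k1_integrandE vab).
apply: cvg_trans; apply: near_eq_cvg; near=> w.
rewrite k1_integrandE//.
have : w \in `]a, b[ by near: w; apply: near_in_itvoo; rewrite in_itv.
by rewrite in_itv.
Unshelve. all: by end_near. Qed.

(** The antiderivative is [- (h1 a b \o tau1 a b)], and [tau1] cancels [xi1] at the end points. The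
    bounds are exchanged because [xi1] is decreasing. *)
Lemma integral_k1_integrand t u : t < u ->
  (\int[lebesgue_measure]_(v in `[xi1 a b u, xi1 a b t])
     (k1_integrand v)%:E = (h1 a b u - h1 a b t)%:E)%E.
Proof.
move=> tu.
have inab v : v \in `[xi1 a b u, xi1 a b t] -> a < v < b.
  have [/andP[au _] /andP[_ tb]] := (xi1_itv u, xi1_itv t).
  rewrite in_itv/= => /andP[uv vt].
  by rewrite (lt_le_trans au)// (le_lt_trans vt).
have dF v : v \in `[xi1 a b u, xi1 a b t] ->
    is_derive v 1 (- (h1 a b \o tau1 a b)) (k1_integrand v).
  move=> /inab vab; rewrite (k1_integrandE vab).
  have /flat_coordinate_h1_tau1[d1 _ _] : `]a, b[%classic v.
    by rewrite /= in_itv.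
  exact: is_deriveN.
have cF v : v \in `[xi1 a b u, xi1 a b t] ->
    {for v, continuous (- (h1 a b \o tau1 a b))}.
  move=> /dF[dv _]; apply: differentiable_continuous.
  exact/derivable1_diffP.
have ut := xi1_decreasing tu.
rewrite (@continuous_FTC2 _ _ (- (h1 a b \o tau1 a b)))//.
- by rewrite !fctE /= !xi1K -EFinB opprK addrC.
- apply: continuous_in_subspaceT => v; rewrite inE/= => /inab.
  exact: continuous_k1_integrand.
- split.
  + by move=> v /subset_itv_oo_cc /dF[].
  + by apply/cvg_at_right_filter/cF; rewrite in_itv/= lexx ltW.
  + by apply/cvg_at_left_filter/cF; rewrite in_itv/= lexx ltW.
- move=> v /subset_itv_oo_cc vut; rewrite derive1E.
  by apply: derive_val; exact: dF.
Qed.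

(** The half-open interval is exhausted by the segments [F n], away from the singularity at [a].
    Monotone convergence gives the integral as the limit of [h1 a b (t + n.+1%:R) - h1 a b t], where
    the first term tends to [pi]. *)
Lemma k1_xi1 t : k1 a b (xi1 a b t) = pi - h1 a b t.
Proof.
(* The shift [n.+1] keeps every segment nondegenerate, including the one for [n = 0]. *)
pose F n := `[xi1 a b (t + n.+1%:R), xi1 a b t]%classic.
have tn n : t < t + n.+1%:R by rewrite ltrDl ltr0n.
have homoF : {homo F : n m / (n <= m)%N >-> (n <= m)%O}.
  move=> n m nm; rewrite subsetEset; apply: subset_itvr.
  rewrite bnd_simp; have [->//|nm'] := eqVneq n m.
  by apply/ltW/xi1_decreasing; rewrite ltrD2l ltr_nat ltnS ltn_neqAle nm' nm.
have FE : \bigcup_n F n = `]a, xi1 a b t]%classic.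
  apply/seteqP; split=> v.
    move=> [n _]; rewrite /F /= !in_itv/= => /andP[nv ->]; rewrite andbT.
    by have /andP[an _] := xi1_itv (t + n.+1%:R); exact: lt_le_trans nv.
  rewrite /= in_itv/= => /andP[av vt].
  have vab : a < v < b.
    by rewrite av/=; have /andP[_ tb] := xi1_itv t; exact: le_lt_trans tb.
  (* The point [v] lies in [F n] as soon as [tau1 a b v <= t + n.+1%:R]. *)
  exists (Num.truncn (tau1 a b v - t)) => //=.
  rewrite /F /= in_itv/= vt andbT -[leRHS](tau1K vab); apply/ltW/xi1_decreasing.
  by rewrite -ltrBlDl truncnS_gt.
have inab n v : F n v -> a < v < b.
  have [/andP[an _] /andP[_ tb]] := (xi1_itv (t + n.+1%:R), xi1_itv t).
  rewrite /F/= in_itv/= => /andP[nv vt].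
  by rewrite (lt_le_trans an)// (le_lt_trans vt).
have mF n : measurable_fun (F n) (EFin \o k1_integrand).
  have cF : {within F n, continuous k1_integrand}.
    apply: continuous_in_subspaceT => v; rewrite inE => /inab.
    exact: continuous_k1_integrand.
  apply/measurable_EFinP; apply: subspace_continuous_measurable_fun => //.
  exact: measurable_itv.
have lim_int : (h1 a b (t + n.+1%:R) - h1 a b t)%:E @[n --> \oo] -->
    (\int[lebesgue_measure]_(v in `]a, xi1 a b t]) (k1_integrand v)%:E)%E.
  rewrite -FE; under eq_fun => n do rewrite -(integral_k1_integrand (tn n)).
  apply: ge0_nondecreasing_set_cvg_integral => // n.
  - exact: measurable_itv.
  - by move=> v _; rewrite lee_fin invr_ge0 sqrtr_ge0.
have lim_h : (h1 a b (t + n.+1%:R) - h1 a b t)%:E @[n --> \oo] -->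
    (pi - h1 a b t)%:E.
  apply: cvg_EFin; first exact: nearW.
  apply: cvgB; last exact: cvg_cst.
  by have := cvg_h1_pi t; rewrite -cvg_shiftS.
by rewrite /k1 /Rintegral (cvg_unique _ lim_int lim_h).
Qed.

End OneCoordinate.

(** * The metrics M'' and G *)

Section Metrics.
Context {R : realType} {d : nat}.
Variables a b : 'I_d -> R.
Hypothesis ab : forall n, a n < b n.
Implicit Types x y : 'rV[R]_d.

Lemma partial_M i x : partial i (M a b) x = - xi1 (a i) (b i) (x 0 i).
Proof.
rewrite /partial.
(* The direction induced on the coordinate [n] is [0] or [1], so derivability is needed in all
   directions [v]. *)
have dM n t v : derivable (M1 (a n) (b n)) t v.
  apply: diff_derivable; apply/derivable1_diffP.
  by case: (is_derive_M1 (a n) (b n) t).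
rewrite (_ : M a b = \sum_n (fun y : 'rV[R]_d => M1 (a n) (b n) (y 0 n))).
  rewrite derive_sum => [|n]; last first.
    exact: derivable_coord.
  rewrite (bigD1 i)//= big1 ?addr0 => [|n ni]; rewrite derive_coord mxE.
    by rewrite !eqxx; apply: derive_val; apply: is_derive_M1.
  by rewrite (negbTE ni) derive0.
by apply/funext => y; rewrite fct_sumE.
Qed.

Lemma metricME x :
  metricM a b x = diag_mx (\row_n dh1 (a n) (b n) (x 0 n) ^+ 2).
Proof.
apply/matrixP => i j; rewrite !mxE.
have -> : partial j (M a b) = fun y => - xi1 (a j) (b j) (y 0 j).
  by apply/funext => y; exact: partial_M.
rewrite /partial (derive_coord (fun t => - xi1 (a j) (b j) t)) mxE eqxx/=.
rewrite eq_sym; have [->|_] := eqVneq j i; last by rewrite derive0.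
have dxi := is_derive_xi1 (a i) (b i) (x 0 i).
rewrite mulr1n (_ : (fun t => _) = - xi1 (a i) (b i)); last exact/funext.
by apply: derive_val; apply: is_derive_eq; rewrite opprK.
Qed.

Lemma jacobian_tau x : box a b x ->
  jacobian (tau a b) x = diag_mx (\row_n dtau1 (a n) (b n) (x 0 n)).
Proof.
move=> bx; apply/matrixP => i j.
have dtau n := is_derive_tau1 (ab n) (bx n).
have difft : differentiable (tau a b) x.
  apply: (@differentiable_row _ _ (fun n => tau1 (a n) (b n))) => n.
  by case: (dtau n).
(* Row [i] of the Jacobian is the derivative along the basis vector [i], computed coordinate by
   coordinate. *)
have -> : jacobian (tau a b) x i j =
    ((delta_mx 0 i : 'rV[R]_d) *m jacobian (tau a b) x) 0 j.
  by rewrite -rowE [RHS]mxE.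
rewrite -deriveEjacobian// derive_mx; last exact: diff_derivable.
rewrite !mxE.
rewrite (_ : (fun t : 'rV_d => _) = (fun y => tau1 (a j) (b j) (y 0 j))).
  rewrite derive_coord mxE eqxx/= eq_sym.
  have [->|_] := eqVneq j i; last by rewrite derive0.
  by apply: derive_val; exact: dtau.
by apply/funext => y; rewrite mxE.
Qed.

(** All three factors of the pullback are diagonal, and each entry is the square of the derivative
    of [h1 \o tau1] by the chain rule. *)
Lemma metricGE x : box a b x ->
  metricG a b x = diag_mx (\row_n dh1_tau1 (a n) (b n) (x 0 n) ^+ 2).
Proof.
move=> bx; rewrite /metricG /pullback_metric jacobian_tau// metricME.
rewrite tr_diag_mx !mulmx_diag; congr diag_mx; apply/rowP => n.
by rewrite !mxE /dh1_tau1; ring.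
Qed.

(** A geodesic must have a [C^2] extension, so [xi] is applied to the whole extension [e]. The
    explicit derivatives serve to compare the two geodesic equations. *)
Lemma of_class_C2_xi (e : R -> 'rV[R]_d) : of_class_C 2 e ->
  [/\ of_class_C 2 (fun t => xi a b (e t)),
    forall t n, derive1 (fun t => xi a b (e t)) t 0 n =
      - dh1 (a n) (b n) (e t 0 n) ^+ 2 * derive1 e t 0 n &
    forall t n, derive1n 2 (fun t => xi a b (e t)) t 0 n =
      - 2 * dh1 (a n) (b n) (e t 0 n) * ddh1 (a n) (b n) (e t 0 n) *
        derive1 e t 0 n ^+ 2 -
      dh1 (a n) (b n) (e t 0 n) ^+ 2 * derive1n 2 e t 0 n].
Proof.
move=> [de ce].
have e1 (t : R) n : is_derive t 1 (fun u => e u 0 n) (derive1 e t 0 n).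
  exact: is_derive_row n (de 0 isT t).
have e2 (t : R) n :
    is_derive t 1 (fun u => derive1 e u 0 n) (derive1n 2 e t 0 n).
  exact: is_derive_row n (de 1 isT t).
set x := fun t => xi a b (e t).
have x1 (t : R) n : is_derive t 1 (fun u => x u 0 n)
    (- dh1 (a n) (b n) (e t 0 n) ^+ 2 * derive1 e t 0 n).
  rewrite (_ : (fun u => _) = xi1 (a n) (b n) \o (fun u => e u 0 n)).
    by apply: is_derive1_comp; exact: is_derive_xi1.
  by apply/funext => u; rewrite mxE.
have dx (t : R) : derivable x t 1 by apply/derivable_rowP => n; case: (x1 t n).
have x1E t n : derive1 x t 0 n =
    - dh1 (a n) (b n) (e t 0 n) ^+ 2 * derive1 e t 0 n.
  by rewrite derive1_row// derive1E; apply: derive_val; exact: x1.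
have dh n (t : R) : is_derive t 1 (fun u => dh1 (a n) (b n) (e u 0 n))
    (ddh1 (a n) (b n) (e t 0 n) * derive1 e t 0 n).
  apply: (@is_derive1_comp _ (dh1 (a n) (b n)) (fun u => e u 0 n)).
  exact: is_derive_dh1.
pose D2 n (t : R) :=
  - 2 * dh1 (a n) (b n) (e t 0 n) * ddh1 (a n) (b n) (e t 0 n) *
  derive1 e t 0 n ^+ 2 - dh1 (a n) (b n) (e t 0 n) ^+ 2 * derive1n 2 e t 0 n.
have x2 (t : R) n : is_derive t 1 (fun u => derive1 x u 0 n) (D2 n t).
  have dht := dh n t; have e2t := e2 t n.
  rewrite (_ : (fun u => _) = - ((fun u => dh1 (a n) (b n) (e u 0 n)) ^+ 2) *
      (fun u => derive1 e u 0 n)); last by apply/funext => u; rewrite x1E.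
  by apply: is_derive_eq; rewrite /GRing.scale /= /D2 !fctE; ring.
have ddx (t : R) : derivable (derive1 x) t 1.
  by apply/derivable_rowP => n; case: (x2 t n).
have x2E t n : derive1n 2 x t 0 n = D2 n t.
  transitivity (derive1 (fun u => derive1 x u 0 n) t).
    exact: derive1_row (ddx t).
  rewrite derive1E.
  by apply: derive_val; exact: x2.
have derivable_continuous (f : R -> R) (t l : R) :
    is_derive t 1 f l -> {for t, continuous f}.
  move=> [df _]; apply: differentiable_continuous.
  exact/derivable1_diffP.
split; [split|exact: x1E|exact: x2E].
  move=> [|[|m]] m2 t.
  - exact: (dx t).
  - exact: (ddx t).
  - by move: m2; rewrite !ltnS ltn0.
apply: continuous_row => n.
rewrite (_ : (fun u => _) = D2 n); last by apply/funext => u; rewrite x2E.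
have cdh t := derivable_continuous _ _ _ (dh n t).
have ce1 t := derivable_continuous _ _ _ (e2 t n).
have ce2 t : {for t, continuous (fun u => derive1n 2 e u 0 n)}.
  apply: (@continuous_comp _ _ _ (derive1n 2 e) (fun y : 'rV[R]_d => y 0 n)).
    exact: ce.
  exact: coord_continuous.
have cddh t : {for t, continuous (fun u => ddh1 (a n) (b n) (e u 0 n))}.
  apply: (@continuous_comp _ _ _ (fun u => e u 0 n)).
    exact: derivable_continuous (e1 t n).
  exact: continuous_ddh1.
move=> t; rewrite (_ : D2 n =
  cst (- 2) * (fun u => dh1 (a n) (b n) (e u 0 n)) *
  (fun u => ddh1 (a n) (b n) (e u 0 n)) * (fun u => derive1 e u 0 n) *
  (fun u => derive1 e u 0 n) -
  (fun u => dh1 (a n) (b n) (e u 0 n)) * (fun u => dh1 (a n) (b n) (e u 0 n)) *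
  (fun u => derive1n 2 e u 0 n)).
  apply: continuousB; repeat (apply: continuousM => //); exact: cvg_cst.
by apply/funext => u; rewrite /D2 !fctE; ring.
Qed.

(** * Transport of geodesics and the two distances *)

Let IM := fun _ : 'I_d => [set: R].
Let IG n := `]a n, b n[%classic.

Let row_boxM : row_box IM = setT. Proof. by apply/seteqP; split. Qed.

Let row_boxG : row_box IG = box a b.
Proof.
by apply/seteqP; split=> x /= bx n; have := bx n; rewrite /IG/= in_itv.
Qed.

Let openM n : open (IM n). Proof. exact: openT. Qed.
Let openG n : open (IG n). Proof. exact: interval_open. Qed.

Let flatM n := flat_coordinate_h1 (ab n).
Let flatG n := flat_coordinate_h1_tau1 (ab n).

Let metricM_diag x : row_box IM x ->
  metricM a b x = diag_mx (\row_n dh1 (a n) (b n) (x 0 n) ^+ 2).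
Proof. by move=> _; exact: metricME. Qed.

Let metricG_diag x : row_box IG x ->
  metricG a b x = diag_mx (\row_n dh1_tau1 (a n) (b n) (x 0 n) ^+ 2).
Proof. by rewrite row_boxG; exact: metricGE. Qed.

Lemma xi_box x : box a b (xi a b x).
Proof. by move=> n; rewrite mxE; exact: xi1_itv. Qed.

Lemma geodesic_xi x y c : geodesic setT (metricM a b) x y c ->
  geodesic (box a b) (metricG a b) (xi a b x) (xi a b y)
    (fun t => xi a b (c t)).
Proof.
case=> [c0 c1 [e [Ce ce ge]]].
split; [by rewrite c0|by rewrite c1|exists (fun t => xi a b (e t))].
have [Cx x1 x2] := of_class_C2_xi Ce.
split=> // [t t01|t /ge[_ get]]; first by rewrite ce.
split; first exact: xi_box.
have Uxi : row_box IG (xi a b (e t)) by rewrite row_boxG; exact: xi_box.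
apply/(geodesic_equation_flat openG flatG metricG_diag Uxi) => k.
have Ue : row_box IM (e t) by rewrite row_boxM.
have /(_ k) geq := (geodesic_equation_flat openM flatM metricM_diag Ue).1 get.
(* The left sides of the two equations are equal: both are the second derivative of
   [h1 (a k) (b k) (e t 0 k)]. The terms in the squared velocity match by [ddh1_tau1_xi1]. *)
rewrite x1 x2 mxE (dh1_tau1_xi1 (ab k)) -[RHS]geq.
rewrite -[X in _ = _ + X * _](ddh1_tau1_xi1 (ab k)) (dh1_tau1_xi1 (ab k)).
by field; rewrite gt_eqF// dh1_gt0.
Qed.

Lemma sqr_distM x y c : geodesic setT (metricM a b) x y c ->
  distM a b x y ^+ 2 =
  \sum_n (h1 (a n) (b n) (x 0 n) - h1 (a n) (b n) (y 0 n)) ^+ 2.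
Proof.
rewrite /distM -row_boxM => gc.
rewrite (geodesic_distance_flat openM flatM metricM_diag gc) sqr_sqrtr//.
by apply: sumr_ge0 => n _; exact: sqr_ge0.
Qed.

Lemma sqr_distG x y c : geodesic (box a b) (metricG a b) x y c ->
  distG a b x y ^+ 2 =
  \sum_n (h1 (a n) (b n) (tau1 (a n) (b n) (x 0 n)) -
          h1 (a n) (b n) (tau1 (a n) (b n) (y 0 n))) ^+ 2.
Proof.
rewrite /distG -row_boxG => gc.
rewrite (geodesic_distance_flat openG flatG metricG_diag gc) sqr_sqrtr//.
by apply: sumr_ge0 => n _; exact: sqr_ge0.
Qed.

End Metrics.

Theorem theorem5p4 (R : realType) (N : nat) (hN : (1 <= N)%N)
    (a b : 'I_(N ^ 2) -> R) (hab : forall n, a n < b n)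
    (p q : 'rV[R]_(N ^ 2)) (c : R -> 'rV[R]_(N ^ 2))
    (hc : geodesic setT (metricM a b) p q c) :
  geodesic (box a b) (metricG a b) (xi a b p) (xi a b q)
    (fun t => xi a b (c t)) /\
  [/\ distG a b (xi a b p) (xi a b q) ^+ 2 =
        \sum_n (k1 (a n) (b n) (xi a b p 0 n)
                - k1 (a n) (b n) (xi a b q 0 n)) ^+ 2,
      \sum_n (k1 (a n) (b n) (xi a b p 0 n)
              - k1 (a n) (b n) (xi a b q 0 n)) ^+ 2 =
        \sum_n (h1 (a n) (b n) (p 0 n) - h1 (a n) (b n) (q 0 n)) ^+ 2 &
      \sum_n (h1 (a n) (b n) (p 0 n) - h1 (a n) (b n) (q 0 n)) ^+ 2 =
        distM a b p q ^+ 2].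
Proof.
have geoG := geodesic_xi hab hc.
have kh : \sum_n (k1 (a n) (b n) (xi a b p 0 n)
              - k1 (a n) (b n) (xi a b q 0 n)) ^+ 2 =
    \sum_n (h1 (a n) (b n) (p 0 n) - h1 (a n) (b n) (q 0 n)) ^+ 2.
  (* The constant [pi] cancels in each difference, and squaring removes the remaining sign. *)
  by apply: eq_bigr => n _; rewrite !mxE !k1_xi1//; ring.
split; first exact: geoG.
split; [|exact: kh|by rewrite (sqr_distM hab hc)].
rewrite kh (sqr_distG hab geoG); apply: eq_bigr => n _.
by rewrite !mxE !xi1K.
Qed.
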